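(* Let $b,m:[0,\infty)\to\mathbb R$ be continuous. Suppose that the limits $b_0=\lim_{t\to\infty}(1+t)b(t)$ and $m_0=\lim_{t\to\infty}(1+t)^2m(t)$ exist, that $$\int_1^\infty |t\,b(t)-b_0|\,\frac{dt}{t}<\infty,\qquad \int_1^\infty |t^2m(t)-m_0|\,\frac{dt}{t}<\infty,$$ and that $4m_0\neq(b_0-1)^2$. Let $N>0$, and for $\xi\in\mathbb R^n$ let $\mathcal E(t,s,\xi)\in\mathbb C^{2\times2}$ be the fundamental solution of the system $$(1+t)\partial_tU(t,\xi)=\big(A+R(t,\xi)\big)U(t,\xi),$$ $$A=\begin{pmatrix}-1& iN\\ \frac{i m_0}{N}&-b_0\end{pmatrix},\qquad R(t,\xi)=\begin{pmatrix}0&0\\ \frac{i(1+t)^2|\xi|^2+i\left((1+t)^2m(t)-m_0\right)}{N}& b_0-(1+t)b(t)\end{pmatrix},$$ that is, $(1+t)\partial_t\mathcal E(t,s,\xi)=(A+R(t,\xi))\mathcal E(t,s,\xi)$ and $\mathcal E(s,s,\xi)=\mathrm I$. Let $$\mu_+=-\frac{b_0+1}2+\sqrt{\frac{(b_0-1)^2}4-m_0}$$ (for a negative radicand the root is purely imaginary). Then there is a constant $C$ such that $$\|\mathcal E(t,s,\xi)\|\le C\Big(\frac{1+t}{1+s}\Big)^{\operatorname{Re}\mu_+}$$ for all $0\le s\le t$ and all $\xi\in\mathbb R^n$ with $(1+t)|\xi|\le N$.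
   Context: The system is the first-order form of $\widehat u_{tt}+|\xi|^2\widehat u+b(t)\widehat u_t+m(t)\widehat u=0$ for $U=\big(\frac{N}{1+t}\widehat u,\,-i\partial_t\widehat u\big)^T$. $\mu_+$ is the eigenvalue of $A$ with the larger real part (when the eigenvalues are real). *)

(* Defs.v *)
From HB Require Import structures.
From mathcomp Require Import all_boot all_order all_algebra.
From mathcomp Require Export complex.
From mathcomp Require Import all_classical all_reals all_analysis.

Set Implicit Arguments.
Unset Strict Implicit.
Unset Printing Implicit Defensive.

Import Order.TTheory GRing.Theory Num.Theory numFieldNormedType.Exports.

Local Open Scope classical_set_scope.
Local Open Scope ring_scope.
Local Open Scope complex_scope.

(* The modulus topology on R[i]; it makes 'M[R[i]]_(m, n) a normed module over
   R[i] for the maximum of the moduli of the entries.  As for every numeric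
   field, the norm takes its (real, nonnegative) values in R[i]. *)
HB.instance Definition _ (R : rcfType) :=
  NormedModule.copy R[i] (GRing.regular R[i]).

(* The norm of 'rV[R]_n in the library is the maximum norm. *)
Definition euclidean_norm (R : realType) (n : nat) (xi : 'rV[R]_n) : R :=
  Num.sqrt (\sum_(j < n) xi ord0 j ^+ 2).

Definition mx22 (K : pzRingType) (a b c d : K) : 'M[K]_2 :=
  \matrix_(i < 2, j < 2) nth 0 (nth [::] [:: [:: a; b]; [:: c; d]] i) j.

(* U' is the derivative at t of U : [0, +oo[ -> 'M[R[i]]_(p, q).  Only the values
   of U on [0, +oo[ matter: the derivative is two-sided for t > 0 and one-sided
   at t = 0. *)
Definition is_derive_nonneg (R : realType) (p q : nat)
    (U : R -> 'M[R[i]]_(p, q)) (t : R) (U' : 'M[R[i]]_(p, q)) : Prop :=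
  ((tau - t)^-1)%:C *: (U tau - U t) @[tau --> within `[0, +oo[ t^'] --> U'.

Definition matA (R : realType) (b0 m0 N : R) : 'M[R[i]]_2 :=
  mx22 (- 1)                 ('i * N%:C)
       ('i * m0%:C / N%:C)   (- b0%:C).

Definition matR (R : realType) (b m : R -> R) (b0 m0 N : R) (n : nat)
    (t : R) (xi : 'rV[R]_n) : 'M[R[i]]_2 :=
  mx22
    0
    0
    (('i * ((1 + t) ^+ 2 * euclidean_norm xi ^+ 2)%:C
      + 'i * ((1 + t) ^+ 2 * m t - m0)%:C) / N%:C)
    (b0 - (1 + t) * b t)%:C.

Definition fundamental_solution (R : realType) (b m : R -> R) (b0 m0 N : R)
    (n : nat) (E : R -> R -> 'rV[R]_n -> 'M[R[i]]_2) : Prop :=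
  forall (s : R) (xi : 'rV[R]_n), 0 <= s ->
    E s s xi = 1%:M /\
    forall t : R, 0 <= t ->
      exists2 dE : 'M[R[i]]_2,
        is_derive_nonneg (fun tau => E tau s xi) t dE &
        (1 + t)%:C *: dE = (matA b0 m0 N + matR b m b0 m0 N t xi) *m E t s xi.

(* sqrtc is the principal square root: for x < 0, sqrtc x%:C = 'i * sqrt (- x). *)
Definition mu_plus (R : realType) (b0 m0 : R) : R[i] :=
  (- ((b0 + 1) / 2))%:C + sqrtc ((b0 - 1) ^+ 2 / 4 - m0)%:C.

(* Main.v *)
(** Put [x = u1] and [z = i N u2].  Then [(1+t) x' = - x + z] and
    [(1+t) z' = - (1+t)^2 (|xi|^2 + m) x - (1+t) b z], a system with real
    coefficients, so that the real and imaginary parts of the columns of [E]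
    decouple.  Let [a = (b0-1)/2], [d = a^2 - m0 <> 0], [v = a x + z].  For
    the unperturbed system the energy [Q = v^2 + |d| x^2] satisfies
    [(1+t) Q' <= 2 (Re mu_+) Q], whatever the sign of [d]; this replaces the
    diagonalisation of [A].  The perturbation adds at most
    [L ((1+t)|xi|^2 + h(t)) Q] to [Q'], where [h] has a bounded primitive by the
    integral hypotheses and [(1+t)^2 |xi|^2 <= N^2] in the zone considered, so
    Gronwall's inequality concludes. *)
Require Import Defs.
From mathcomp Require Import all_boot all_order all_algebra.
From mathcomp Require Import all_classical all_reals all_analysis.
From mathcomp Require Import measurable_realfun ring lra.

Import Order.TTheory GRing.Theory Num.Theory numFieldNormedType.Exports.

Local Open Scope classical_set_scope.
Local Open Scope ring_scope.
Local Open Scope complex_scope.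

(** * Gronwall's inequality *)

(** The product of [Q] and [expR (- F)] has derivative [expR (- F) * (q - f * Q)], which is
    nonpositive. The growth rate enters through a primitive [F], since in the application [F] is
    explicit up to bounded terms. *)
Lemma gronwall (R : realType) (Q F : R -> R) (s t : R) : s <= t ->
  {within `[s, t], continuous Q} -> {within `[s, t], continuous F} ->
  (forall x, x \in `]s, t[ -> exists q f,
     [/\ is_derive x 1 Q q, is_derive x 1 F f & q <= f * Q x]) ->
  Q t <= Q s * expR (F t - F s).
Proof.
move=> st cQ cF dQF.
pose G := (fun x => Q x * expR (- F x)).
have dG x : x \in `]s, t[ -> exists2 g, is_derive x 1 G g & g <= 0.
  move=> /dQF[q [f [dq df qf]]].
  exists (Q x * (- f * expR (- F x)) + expR (- F x) * q).
    have dF : is_derive x 1 (fun x => - F x) (- f) by exact: is_deriveN.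
    have dE : is_derive x 1 (expR \o (fun x => - F x)) (- f * expR (- F x)).
      rewrite mulrC; exact: (@is_derive1_comp R expR (fun x => - F x)).
    exact: (is_deriveM dq dE).
  rewrite -subr_ge0.
  have -> : 0 - (Q x * (- f * expR (- F x)) + expR (- F x) * q) =
    expR (- F x) * (f * Q x - q) by ring.
  by rewrite mulr_ge0 ?expR_ge0 ?subr_ge0.
have : G t <= G s.
  apply: (@ler0_derive1_nincr _ G s t) => //.
  - by move=> x /dG[g [dg _] _].
  - by move=> x /dG[g [dg gE] g0]; rewrite derive1E gE.
  - apply/subspace_continuousP => x xst.
    apply: cvgM; first by move/subspace_continuousP: cQ; apply.
    apply: (cvg_comp (fun x => - F x) expR); last exact: continuous_expR.
    by apply: cvgN; move/subspace_continuousP: cF; apply.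
rewrite /G => Gle.
have -> : Q t = (Q t * expR (- F t)) * expR (F t).
  by rewrite -mulrA -expRD addNr expR0 mulr1.
have -> : Q s * expR (F t - F s) = (Q s * expR (- F s)) * expR (F t).
  by rewrite expRD; ring.
by rewrite ler_wpM2r ?expR_ge0.
Qed.

(** * Dominating functions with bounded primitives *)

Lemma continuous_extend_left (R : realType) (f : R -> R) (a : R) :
  {within `[a, +oo[, continuous f} -> continuous (fun t => f (Num.max a t)).
Proof.
move=> /subspace_continuousP cf t.
have ma x : `[a, +oo[%classic (Num.max a x).
  by rewrite /= in_itv/= andbT le_max lexx.
have cm : {for t, continuous (cst a \max id)}.
  by apply: continuous_max; [exact: cvg_cst|exact: cvg_id].
apply: (cvg_comp (fun t => Num.max a t) f _ (cf _ (ma t))) => U /= wU.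
have : \forall x \near t, `[a, +oo[%classic (Num.max a x) -> U (Num.max a x).
  exact: cm _ wU.
by apply: filterS => x; apply; exact: ma.
Qed.

(** The primitive is the integral from [c] of [f] frozen to the left of [a]; since the integrand is
    nonnegative, the integral over the whole half-line bounds it. *)
Lemma bounded_primitive (R : realType) (f : R -> R) (c a : R) : c <= a ->
  {within `[a, +oo[, continuous f} -> (forall t, a <= t -> 0 <= f t) ->
  (\int[lebesgue_measure]_(t in `[a, +oo[) (f t)%:E < +oo)%E ->
  exists (G : R -> R) (M : R),
    (forall t, c < t -> is_derive t 1 G (f (Num.max a t))) /\
    (forall t, c < t -> 0 <= G t <= M).
Proof.
move=> ca cf f0 intf.
set mu := (@lebesgue_measure R).
pose k t := f (Num.max a t).
have ck : continuous k by exact: continuous_extend_left.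
have k0 t : 0 <= k t by apply: f0; rewrite le_max lexx.
have mk (D : set R) : measurable D -> measurable_fun D k.
  move=> mD; apply: subspace_continuous_measurable_fun => //.
  exact: continuous_subspaceT.
(* Split at [a]: a continuous function on a compact interval, then the tail given by hypothesis. *)
have kcy : (\int[mu]_(t in `[c, +oo[) (k t)%:E < +oo)%E.
  have cE : `[c, +oo[%classic = `[c, a[ `|` `[a, +oo[.
    by rewrite -itv_bndbnd_setU// ?bnd_simp.
  rewrite cE ge0_integral_setU//=; last 3 first.
  - by apply/measurable_EFinP; apply: mk; exact: measurableU.
  - by move=> x _; rewrite lee_fin.
  - apply/disj_set2P/seteqP; split => // x [] /=; rewrite !in_itv/= andbT.
    by move=> /andP[_ xa]; rewrite leNgt xa.
  apply: lte_add_pinfty; last first.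
    apply: le_lt_trans intf; rewrite le_eqVlt; apply/orP; left; apply/eqP.
    apply: eq_integral => t.
    by rewrite inE/= in_itv/= andbT /k => /max_idPr ->.
  apply: (@le_lt_trans _ _ (\int[mu]_(t in `[c, a]) (k t)%:E)%E).
    apply: ge0_subset_integral => //.
    - by apply/measurable_EFinP; apply: mk.
    - by move=> x _; rewrite lee_fin.
    - by apply: subset_itvl; rewrite bnd_simp.
  have := @continuous_compact_integrable _ k _ (@segment_compact _ c a)
    (continuous_subspaceT ck).
  move=> /integrableP[_ h]; apply: (le_lt_trans _ h).
  rewrite le_eqVlt; apply/orP; left; apply/eqP.
  by apply: eq_integral => x _; rewrite gee0_abs ?lee_fin.
have ik t : mu.-integrable `[c, t] (EFin \o k).
  exact: continuous_compact_integrable (@segment_compact _ c t)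
    (continuous_subspaceT ck).
exists (fun t => \int[mu]_(x in `[c, t]) (k x)).
exists (fine (\int[mu]_(t in `[c, +oo[) (k t)%:E)).
split=> t ct.
  (* The end point [t + 1] leaves room to the right of [t] for a two-sided derivative. *)
  have [|//|] := @continuous_FTC1 _ k (BLeft c) t (t + 1) _ (ik _) _ (ck t).
  - by rewrite ltrDl.
  - by rewrite derive1E => dF Fk; split.
apply/andP; split; first by apply: Rintegral_ge0 => x _; exact: k0.
rewrite /Rintegral fine_le//.
- exact: integrable_fin_num (ik t).
- by rewrite ge0_fin_numE// integral_ge0// => x _; rewrite lee_fin.
- apply: ge0_subset_integral => //.
  + by apply/measurable_EFinP; apply: mk.
  + by move=> x _; rewrite lee_fin.
  + by move=> x /=; rewrite !in_itv/= => /andP[-> _].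
Qed.

Lemma is_derive_1addr (R : realType) (t : R) :
  is_derive t 1 (fun y : R => 1 + y) 1.
Proof.
have := is_deriveD (is_derive_cst (1 : R) t 1) (is_derive_id t 1).
by rewrite add0r.
Qed.

(** The integrable [f] controls [g] only beyond 1. On the unit interval the maximum of [|g|] is
    absorbed into a multiple of [(1 + t) ^- 2], whose primitive [1 - (1 + t)^-1] is bounded as
    well. *)
Lemma dominating_primitive (R : realType) (f g : R -> R) (c : R) :
  {within `[0, +oo[, continuous g} -> {within `[1, +oo[, continuous f} ->
  (forall t, 1 <= t -> 0 <= f t) ->
  (\int[lebesgue_measure]_(t in `[1%R, +oo[) (f t)%:E < +oo)%E ->
  (forall t, 1 <= t -> `|g t| <= 2 * f t + c / (1 + t) ^+ 2) ->
  exists (h H : R -> R) (M : R), forall t : R, 0 <= t ->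
    [/\ is_derive t 1 H (h t), `|g t| <= h t & 0 <= H t <= M].
Proof.
move=> cg cf f0 intf gf.
(* Integrating from -1 makes 0 an interior point, so that [H] has a two-sided derivative there
   too. *)
have [] := @bounded_primitive R f (-1) 1 _ cf f0 intf; first by lra.
move=> G [M [dG GM]].
have [u uI gu] : exists2 u, u \in `[0%R, 1%R] &
    forall t, t \in `[0%R, 1%R] -> `|g t| <= `|g u|.
  apply: (EVT_max (f := fun t => `|g t|) ler01).
  apply/subspace_continuousP => x x01.
  apply: cvg_norm.
  have : {within `[0, 1], continuous g}.
    apply: continuous_subspaceW cg => y /=.
    by rewrite !in_itv/= andbT => /andP[].
  by move/subspace_continuousP; apply.
(* The factor 4 is the maximum of [(1 + t) ^+ 2] on the unit interval; [|c|] serves [t >= 1]. *)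
pose d := `|c| + 4 * `|g u|.
have d0 : 0 <= d by rewrite addr_ge0// mulr_ge0.
exists (fun t => 2 * f (Num.max 1 t) + d * (1 + t) ^- 2).
exists (fun t => 2 * G t + d * (1 - (1 + t)^-1)).
exists (2 * M + d) => t t0.
have t1 : 0 < 1 + t by lra.
have t1N : 1 + t != 0 by rewrite gt_eqF.
have tm1 : -1 < t by lra.
split.
- have dGt := dG t tm1.
  have dI := is_deriveV t1N (@is_derive_1addr R t).
  have dB := is_deriveB (is_derive_cst (1 : R) t 1) dI.
  apply: is_derive_eq.
  by rewrite /GRing.scale/=; field.
- have i2 : 0 <= (1 + t) ^- 2 by rewrite invr_ge0 exprn_ge0// ltW.
  have ci : `|c| * (1 + t) ^- 2 <= d * (1 + t) ^- 2.
    by rewrite ler_wpM2r// lerDl mulr_ge0.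
  have [t1'|t1'] := leP 1 t.
    apply: le_trans (gf t t1') _.
    rewrite lerD2l; apply: le_trans ci.
    by rewrite ler_wpM2r// ler_norm.
  have tI : t \in `[0%R, 1%R] by rewrite in_itv/= t0 ltW.
  apply: le_trans (gu _ tI) _.
  rewrite -[leLHS]add0r lerD ?mulr_ge0 ?f0//.
  rewrite ler_pdivlMr ?exprn_gt0// /d.
  have : `|g u| * (1 + t) ^+ 2 <= `|g u| * 4.
    by rewrite ler_wpM2l//; nra.
  have : 0 <= `|c| by [].
  lra.
- have /andP[G0 GM'] := GM t tm1.
  have i0 : 0 <= (1 + t)^-1 by rewrite invr_ge0 ltW.
  have i1 : (1 + t)^-1 <= 1 by rewrite invf_le1//; lra.
  by apply/andP; split; nra.
Qed.

(** * The energy of the real system *)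

(** Here [r] stands for [1 + t]. With [kappa = (b0 + 1) / 2], the unperturbed system reads
    [r x' = - kappa x + v], [r v' = - kappa v + del x], whence
    [r Q' = - 2 kappa Q + 2 (del + |del|) x v]. The terms in [q], [gb], [gm] form a quadratic form
    in [x] and [v], bounded by a multiple of [Q]. *)
Lemma energy_derivative_le (R : realType) (b0 m0 q gb gm x z dx dz r : R) :
  let a := (b0 - 1) / 2 in let del := a ^+ 2 - m0 in
  let v := a * x + z in let L := (1 + `|del|^-1) * (2 + `|a|) in
  del != 0 -> 0 < r -> 0 <= q ->
  dx = (- x + z) / r -> dz = - (m0 / r + q + gm) * x - (b0 / r + gb) * z ->
  2 * v * (a * dx + dz) + 2 * `|del| * x * dx <=
  (2 * (- ((b0 + 1) / 2) + Num.sqrt del) / r + L * (q + `|gb| + `|gm|)) *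
  (v ^+ 2 + `|del| * x ^+ 2).
Proof.
move=> a del v L del0 r0 q0 -> ->.
set s := Num.sqrt del; set D := `|del|; set Q := v ^+ 2 + D * x ^+ 2.
have D0 : 0 < D by rewrite normr_gt0.
(* For [del >= 0] this is [(v - s x)^2 >= 0]. For [del < 0] both sides vanish, as [Num.sqrt] is 0 on
   negative numbers. *)
have main : 2 * (del + D) * x * v <= 2 * s * Q.
  rewrite /Q /D /s; have [d0|d0] := leP 0 del.
    rewrite ger0_norm//.
    have {1 2 4}-> : del = Num.sqrt del ^+ 2 by rewrite sqr_sqrtr.
    set w := Num.sqrt del.
    have w0 : 0 <= w by exact: sqrtr_ge0.
    have := mulr_ge0 w0 (sqr_ge0 (v - w * x)).
    lra.
  by rewrite ltr0_norm// subrr ler0_sqrtr; [lra|exact: ltW].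
have Q1 : v ^+ 2 + x ^+ 2 <= (1 + D^-1) * Q.
  rewrite -subr_ge0 /Q.
  have -> : (1 + D^-1) * (v ^+ 2 + D * x ^+ 2) - (v ^+ 2 + x ^+ 2) =
    D * x ^+ 2 + D^-1 * v ^+ 2 by field; rewrite gt_eqF.
  by rewrite addr_ge0// mulr_ge0// ?invr_ge0 ?sqr_ge0// ltW.
have Q0 : 0 <= (1 + D^-1) * Q by apply: le_trans Q1; rewrite addr_ge0 ?sqr_ge0.
have xv : `|2 * v * x| <= (1 + D^-1) * Q.
  by apply: le_trans Q1; rewrite ler_norml; have := sqr_ge0 (v - x);
    have := sqr_ge0 (v + x); lra.
have vv : 2 * v ^+ 2 <= 2 * ((1 + D^-1) * Q).
  by have := sqr_ge0 x; lra.
have zE : z = v - a * x by rewrite /v; ring.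
(* Substituting [z = v - a x] makes [gb] appear twice: with [v ^+ 2] and, multiplied by [a], with
   [x v]. *)
have -> : 2 * v * (a * ((- x + z) / r) +
      (- (m0 / r + q + gm) * x - (b0 / r + gb) * z)) +
    2 * D * x * ((- x + z) / r) =
   (2 * (- ((b0 + 1) / 2)) * Q + 2 * (del + D) * x * v) / r
   - 2 * v * x * (q + gm - a * gb) - gb * (2 * v ^+ 2).
  by rewrite /Q zE /del /a; field; rewrite gt_eqF.
have h1 : (2 * (- ((b0 + 1) / 2)) * Q + 2 * (del + D) * x * v) / r <=
   2 * (- ((b0 + 1) / 2) + s) / r * Q.
  have -> : 2 * (- ((b0 + 1) / 2) + s) / r * Q =
    (2 * (- ((b0 + 1) / 2)) * Q + 2 * s * Q) / r by field; rewrite gt_eqF.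
  by rewrite ler_wpM2r ?lerD2l// invr_ge0 ltW.
have h2 : - (2 * v * x * (q + gm - a * gb)) <=
   (1 + D^-1) * Q * (q + `|gm| + `|a| * `|gb|).
  apply: le_trans (ler_norm _) _; rewrite normrN normrM ler_pM//.
  apply: le_trans (ler_normB _ _) _; rewrite normrM lerD2r.
  by apply: le_trans (ler_normD _ _) _; rewrite ger0_norm.
have h3 : - (gb * (2 * v ^+ 2)) <= `|gb| * (2 * ((1 + D^-1) * Q)).
  apply: le_trans (ler_norm _) _; rewrite normrN normrM ler_pM//.
  by rewrite ger0_norm// mulr_ge0// sqr_ge0.
(* The two occurrences of [gb] add up to exactly [2 + |a|], the second factor of [L]. *)
have h4 : (1 + D^-1) * Q * (q + `|gm| + `|a| * `|gb|) +
    `|gb| * (2 * ((1 + D^-1) * Q))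
  <= L * (q + `|gb| + `|gm|) * Q.
  rewrite -subr_ge0 /L -/D.
  have -> : (1 + D^-1) * (2 + `|a|) * (q + `|gb| + `|gm|) * Q -
    ((1 + D^-1) * Q * (q + `|gm| + `|a| * `|gb|) +
     `|gb| * (2 * ((1 + D^-1) * Q))) =
    (1 + D^-1) * Q * ((1 + `|a|) * (q + `|gm|)) by ring.
  by rewrite mulr_ge0// mulr_ge0// addr_ge0.
rewrite mulrDl; lra.
Qed.

(** This trades the energy for [x ^+ 2 + z ^+ 2] at the initial and the final time. *)
Lemma energy_equiv (R : realType) (a d x z : R) : 0 < d ->
  let Q := (a * x + z) ^+ 2 + d * x ^+ 2 in
  Q <= (2 + 2 * a ^+ 2 + d) * (x ^+ 2 + z ^+ 2) /\
  x ^+ 2 + z ^+ 2 <= (2 + (1 + 2 * a ^+ 2) / d) * Q.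
Proof.
move=> d0 Q; have i0 : 0 < d^-1 by rewrite invr_gt0.
have a0 := sqr_ge0 a; have x0 := sqr_ge0 x; have z0 := sqr_ge0 z.
have ax0 := mulr_ge0 a0 x0; have az0 := mulr_ge0 a0 z0.
have dz0 := mulr_ge0 (ltW d0) z0; have dx0 := mulr_ge0 (ltW d0) x0.
split.
  by rewrite /Q; have := sqr_ge0 (a * x - z); lra.
have -> : (2 + (1 + 2 * a ^+ 2) / d) * Q = 2 * (a * x + z) ^+ 2 + 2 * d * x ^+ 2
   + (1 + 2 * a ^+ 2) * x ^+ 2 + (1 + 2 * a ^+ 2) / d * (a * x + z) ^+ 2.
  by rewrite /Q; field; rewrite gt_eqF.
have : 0 <= (1 + 2 * a ^+ 2) / d * (a * x + z) ^+ 2.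
  by rewrite mulr_ge0 ?sqr_ge0// mulr_ge0 ?(ltW i0)//; lra.
(* This square is [2 (a x + z)^2 + 2 a^2 x^2 - z^2]. *)
have := sqr_ge0 (2 * a * x + z).
lra.
Qed.

(** * Deviation of damping and mass from the scale-invariant coefficients *)

Lemma continuous_within_itvcy0_1 (R : realType) (f : R -> R) :
  {within `[0, +oo[, continuous f} -> {within `[1, +oo[, continuous f}.
Proof.
apply: continuous_subspaceW => y /=; rewrite !in_itv/= !andbT.
exact: le_trans.
Qed.

Lemma cvg_within_1addr (R : realType) (A : set R) (y : R) :
  (fun r : R => 1 + r) @ within A (nbhs y) --> 1 + y.
Proof.
by apply: cvg_within_filter; apply: cvgD; [exact: cvg_cst|exact: cvg_id].
Qed.

(** The integral hypothesis weighs with [t], the system with [1 + t]; the shift costs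
    [b0 / (t (1 + t))], of order [(1 + t) ^- 2] for [t >= 1]. *)
Lemma damping_dominated (R : realType) (b : R -> R) (b0 : R) :
  {within `[0, +oo[, continuous b} ->
  (\int[lebesgue_measure]_(t in `[1%R, +oo[)
     (`|t * b t - b0| / t)%:E < +oo)%E ->
  exists (h H : R -> R) (M : R), forall t : R, 0 <= t ->
    [/\ is_derive t 1 H (h t), `|b t - b0 / (1 + t)| <= h t & 0 <= H t <= M].
Proof.
move=> cb intb.
have cvgI (A : set R) (y : R) : (fun r : R => r) @ within A (nbhs y) --> y.
  by apply: cvg_within_filter; exact: cvg_id.
apply: (@dominating_primitive R (fun t => `|t * b t - b0| / t) _
  (4 * `|b0|)) => //.
- apply/subspace_continuousP => y; rewrite /= in_itv/= andbT => y0.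
  apply: cvgB.
    by move/subspace_continuousP: cb; apply; rewrite /= in_itv/= andbT.
  apply: cvgM; first exact: cvg_cst.
  by apply: cvgV; [rewrite gt_eqF// ltr_wpDr|exact: cvg_within_1addr].
- apply/subspace_continuousP => y; rewrite /= in_itv/= andbT => y1.
  apply: cvgM; last by apply: cvgV => //; rewrite gt_eqF//; lra.
  apply: cvg_norm; apply: cvgB; last exact: cvg_cst.
  apply: cvgM => //.
  move/continuous_within_itvcy0_1/subspace_continuousP: cb; apply.
  by rewrite /= in_itv/= andbT.
- by move=> t t1; rewrite divr_ge0//; lra.
- move=> t t1; have t0 : 0 < t by lra.
  have -> : b t - b0 / (1 + t) = (t * b t - b0) / t + b0 * (t * (1 + t))^-1.
    by field; rewrite !gt_eqF//; lra.
  apply: le_trans (ler_normD _ _) _; apply: lerD.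
    rewrite normrM normfV (gtr0_norm t0).
    by rewrite ler_peMl ?ler1n// divr_ge0// ltW.
  rewrite normrM [4 * _]mulrC -mulrA ler_wpM2l//.
  rewrite ger0_norm; last by rewrite invr_ge0 mulr_ge0//; lra.
  rewrite -subr_ge0.
  have -> : 4 / (1 + t) ^+ 2 - (t * (1 + t))^-1 =
    (3 * t - 1) / (t * (1 + t) ^+ 2).
    by field; rewrite !gt_eqF//; lra.
  by rewrite divr_ge0 ?mulr_ge0 ?sqr_ge0//; lra.
Qed.

(** Here the shift from [t] to [1 + t] also multiplies the integrable part by [(1 + t) / t <= 2],
    which accounts for the factor 2 in [dominating_primitive]. *)
Lemma mass_dominated (R : realType) (m : R -> R) (m0 : R) :
  {within `[0, +oo[, continuous m} ->
  (\int[lebesgue_measure]_(t in `[1%R, +oo[)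
     (`|t ^+ 2 * m t - m0| / t)%:E < +oo)%E ->
  exists (h H : R -> R) (M : R), forall t : R, 0 <= t ->
    [/\ is_derive t 1 H (h t), `|(1 + t) * m t - m0 / (1 + t)| <= h t &
        0 <= H t <= M].
Proof.
move=> cm intm.
have cvgI (A : set R) (y : R) : (fun r : R => r) @ within A (nbhs y) --> y.
  by apply: cvg_within_filter; exact: cvg_id.
apply: (@dominating_primitive R (fun t => `|t ^+ 2 * m t - m0| / t) _
  (8 * `|m0|)) => //.
- apply/subspace_continuousP => y; rewrite /= in_itv/= andbT => y0.
  apply: cvgB.
    apply: cvgM; first exact: cvg_within_1addr.
    by move/subspace_continuousP: cm; apply; rewrite /= in_itv/= andbT.
  apply: cvgM; first exact: cvg_cst.
  by apply: cvgV; [rewrite gt_eqF// ltr_wpDr|exact: cvg_within_1addr].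
- apply/subspace_continuousP => y; rewrite /= in_itv/= andbT => y1.
  apply: cvgM; last by apply: cvgV => //; rewrite gt_eqF//; lra.
  apply: cvg_norm; apply: cvgB; last exact: cvg_cst.
  apply: cvgM; first by apply: cvgM.
  move/continuous_within_itvcy0_1/subspace_continuousP: cm; apply.
  by rewrite /= in_itv/= andbT.
- by move=> t t1; rewrite divr_ge0//; lra.
- move=> t t1; have t0 : 0 < t by lra.
  have -> : (1 + t) * m t - m0 / (1 + t) =
    (1 + t) / t * ((t ^+ 2 * m t - m0) / t) +
    m0 * ((1 + 2 * t) / (t ^+ 2 * (1 + t))).
    by field; rewrite !gt_eqF//; lra.
  apply: le_trans (ler_normD _ _) _; apply: lerD.
    rewrite normrM [X in _ * X]normrM normfV (gtr0_norm t0).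
    rewrite ler_wpM2r//; first by rewrite divr_ge0// ltW.
    rewrite ger0_norm; last by rewrite divr_ge0//; lra.
    by rewrite ler_pdivrMr//; lra.
  have -> : 8 * `|m0| / (1 + t) ^+ 2 = `|m0| * (8 / (1 + t) ^+ 2) by ring.
  rewrite normrM ler_wpM2l//.
  rewrite ger0_norm; last by rewrite divr_ge0// ?mulr_ge0 ?sqr_ge0//; lra.
  rewrite -subr_ge0.
  have -> : 8 / (1 + t) ^+ 2 - (1 + 2 * t) / (t ^+ 2 * (1 + t)) =
    (6 * t ^+ 2 - 3 * t - 1) / (t ^+ 2 * (1 + t) ^+ 2).
    by field; rewrite !gt_eqF//; lra.
  rewrite divr_ge0//; last by apply: mulr_ge0; exact: sqr_ge0.
  (* The numerator is [6 (t - 1) t + 3 t - 1]. *)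
  have : 0 <= (t - 1) * t by rewrite mulr_ge0//; lra.
  lra.
Qed.

(** * Growth of the real system in the zone *)

(** The number [k] stands for [|xi|]; choosing [K] before it makes the estimate uniform in the
    frequency. The power is squared because the energy is quadratic. *)
Lemma real_system_bound (R : realType) (b m : R -> R) (b0 m0 N : R) :
  {within `[0, +oo[, continuous b} -> {within `[0, +oo[, continuous m} ->
  (\int[lebesgue_measure]_(t in `[1%R, +oo[)
     (`|t * b t - b0| / t)%:E < +oo)%E ->
  (\int[lebesgue_measure]_(t in `[1%R, +oo[)
     (`|t ^+ 2 * m t - m0| / t)%:E < +oo)%E ->
  4 * m0 <> (b0 - 1) ^+ 2 -> 0 < N ->
  exists K : R, forall (x z : R -> R) (k s t : R),
    0 <= s -> s <= t -> 0 <= k -> (1 + t) * k <= N ->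
    {within `[0, +oo[, continuous x} -> {within `[0, +oo[, continuous z} ->
    (forall r : R, 0 < r -> exists dx dz : R,
      [/\ is_derive r 1 x dx, is_derive r 1 z dz,
        (1 + r) * dx = - x r + z r &
        (1 + r) * dz = - ((1 + r) ^+ 2 * (k ^+ 2 + m r)) * x r
                       - (1 + r) * b r * z r]) ->
    x t ^+ 2 + z t ^+ 2 <= K * (x s ^+ 2 + z s ^+ 2) *
      (((1 + t) / (1 + s))
         `^ (- ((b0 + 1) / 2) + Num.sqrt ((b0 - 1) ^+ 2 / 4 - m0))) ^+ 2.
Proof.
move=> cb cm intb intm disc N0.
have [hb [Hb [Mb Pb]]] := @damping_dominated R b b0 cb intb.
have [hm [Hm [Mm Pm]]] := @mass_dominated R m m0 cm intm.
pose a := (b0 - 1) / 2; pose del := a ^+ 2 - m0.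
have delE : (b0 - 1) ^+ 2 / 4 - m0 = del by rewrite /del /a; field.
have del0 : del != 0.
  by apply/eqP => d0; apply: disc; move: d0; rewrite -delE; lra.
have D0 : 0 < `|del| by rewrite normr_gt0.
pose mu := - ((b0 + 1) / 2) + Num.sqrt del.
pose L := (1 + `|del|^-1) * (2 + `|a|).
have L0 : 0 <= L by rewrite mulr_ge0// addr_ge0// invr_ge0.
pose c1 := 2 + 2 * a ^+ 2 + `|del|; pose c2 := 2 + (1 + 2 * a ^+ 2) / `|del|.
(* [c1] and [c2] compare [Q] with [x ^+ 2 + z ^+ 2] at [s] and [t]; the exponential bounds all of
   [F t - F s] but the logarithms. *)
pose K := c2 * c1 * expR (L * (N ^+ 2 / 2 + Mb + Mm)).
exists K => x z k s t s0 st k0 tk cx cz sys.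
pose Q y := (a * x y + z y) ^+ 2 + `|del| * x y ^+ 2.
(* A primitive of the rate in [energy_derivative_le] for [q = (1 + y) k^2], with the deviations
   replaced by their dominating functions. *)
pose F y := 2 * mu * ln (1 + y) + L * (k ^+ 2 / 2 * (1 + y) ^+ 2 + Hb y + Hm y).
have dF (r : R) : 0 <= r -> is_derive r 1 F
    (2 * mu / (1 + r) + L * ((1 + r) * k ^+ 2 + hb r + hm r)).
  move=> r0.
  have r1 : 0 < 1 + r by rewrite ltr_wpDr.
  have r1N : 1 + r != 0 by rewrite gt_eqF.
  have [dHb _ _] := Pb r r0; have [dHm _ _] := Pm r r0.
  have di := @is_derive_1addr R r.
  have dln : is_derive r 1 (@ln R \o (fun y : R => 1 + y)) ((1 + r)^-1 * 1).
    by apply: is_derive1_comp; exact: is_derive1_ln.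
  have dsq := is_deriveM di di.
  have d1 := is_deriveZ (2 * mu) dln.
  have d2 := is_deriveD (is_deriveD (is_deriveZ (k ^+ 2 / 2) dsq) dHb) dHm.
  have d3 := is_deriveD d1 (is_deriveZ L d2).
  apply: is_derive_eq.
  by rewrite /GRing.scale/=; field.
have QF : Q t <= Q s * expR (F t - F s).
  apply: gronwall => //.
  - apply/subspace_continuousP => y; rewrite /= in_itv/= => /andP[sy yt].
    have sub (f : R -> R) : {within `[0, +oo[, continuous f} ->
        f @ within `[s, t] (nbhs y) --> f y.
      move=> cf; have : {within `[s, t], continuous f}.
        apply: continuous_subspaceW cf => r /=; rewrite !in_itv/= andbT.
        by move=> /andP[sr _]; exact: le_trans sr.
      by move/subspace_continuousP; apply; rewrite /= in_itv/= sy.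
    have cQ1 : (fun r => a * x r + z r) @ within `[s, t] (nbhs y) -->
        a * x y + z y.
      by apply: cvgD; [apply: cvgM; [exact: cvg_cst|exact: sub]|exact: sub].
    apply: cvgD; first by apply: cvgM.
    by apply: cvgM; [exact: cvg_cst|apply: cvgM; exact: sub].
  - apply/subspace_continuousP => y; rewrite /= in_itv/= => /andP[sy yt].
    apply: cvg_within_filter; apply: differentiable_continuous.
    by apply/derivable1_diffP; have [] := dF y (le_trans s0 sy).
  - move=> r; rewrite in_itv/= => /andP[sr rt].
    have r0 : 0 < r by exact: le_lt_trans sr.
    have r1 : 0 < 1 + r by rewrite addr_gt0.
    have r1N : 1 + r != 0 by rewrite gt_eqF.
    have [dx [dz [dxE dzE xE zE]]] := sys r r0.
    have [dHb hbb _] := Pb r (ltW r0).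
    have [dHm hmm _] := Pm r (ltW r0).
    exists (2 * (a * x r + z r) * (a * dx + dz) + 2 * `|del| * x r * dx).
    exists (2 * mu / (1 + r) + L * ((1 + r) * k ^+ 2 + hb r + hm r)).
    split.
    + have d1 : is_derive r 1 (fun y => a * x y + z y) (a * dx + dz).
        exact: (is_deriveD (is_deriveZ a dxE) dzE).
      have d2 := is_deriveD (is_deriveM d1 d1)
        (is_deriveZ `|del| (is_deriveM dxE dxE)).
      apply: is_derive_eq.
      by rewrite /GRing.scale/=; ring.
    + exact: dF (ltW r0).
    + have := @energy_derivative_le R b0 m0 ((1 + r) * k ^+ 2)
        (b r - b0 / (1 + r))
        ((1 + r) * m r - m0 / (1 + r)) (x r) (z r) dx dz (1 + r) del0 r1.
      rewrite -/a -/del -/L -/mu => /(_ _ _ _) /le_trans; apply.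
      * by rewrite mulr_ge0 ?sqr_ge0// ltW.
      * by rewrite -xE mulrC mulKf.
      * by apply: (mulfI r1N); rewrite zE; field.
      * apply: ler_wpM2r.
          by apply: addr_ge0; [|apply: mulr_ge0 => //]; exact: sqr_ge0.
        by rewrite lerD2l ler_wpM2l// lerD// lerD.
have s1 : 0 < 1 + s by rewrite ltr_wpDr.
have t0 : 0 <= t by exact: le_trans st.
have t1 : 0 < 1 + t by rewrite ltr_wpDr.
rewrite delE -/mu.
have -> : (((1 + t) / (1 + s)) `^ mu) ^+ 2 =
    expR (2 * mu * (ln (1 + t) - ln (1 + s))).
  rewrite /powR gt_eqF ?divr_gt0// ln_div ?posrE// expr2 -expRD.
  by congr expR; ring.
have [_ _ /andP[Hbs _]] := Pb s s0; have [_ _ /andP[_ Hbt]] := Pb t t0.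
have [_ _ /andP[Hms _]] := Pm s s0; have [_ _ /andP[_ Hmt]] := Pm t t0.
have Fle : F t - F s <= 2 * mu * (ln (1 + t) - ln (1 + s)) +
    L * (N ^+ 2 / 2 + Mb + Mm).
  rewrite /F.
  (* The zone condition bounds the frequency term at [t] by [N ^+ 2 / 2]; the one at [s] is
     subtracted and dropped by its sign. *)
  have kt : ((1 + t) * k) ^+ 2 <= N ^+ 2.
    by rewrite ler_pXn2r ?nnegrE ?mulr_ge0// ltW.
  have ks : 0 <= k ^+ 2 / 2 * (1 + s) ^+ 2.
    by apply: mulr_ge0; [apply: divr_ge0 => //; exact: sqr_ge0|exact: sqr_ge0].
  have := ler_wpM2l L0 (_ : k ^+ 2 / 2 * (1 + t) ^+ 2 + Hb t + Hm t -
    (k ^+ 2 / 2 * (1 + s) ^+ 2 + Hb s + Hm s) <= N ^+ 2 / 2 + Mb + Mm).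
  move=> /(_ ltac:(lra)); lra.
have [Q1 _] := @energy_equiv R a _ (x s) (z s) D0.
have [_ Q2] := @energy_equiv R a _ (x t) (z t) D0.
have c20 : 0 <= c2.
  by rewrite addr_ge0// divr_ge0 ?(ltW D0)// addr_ge0// mulr_ge0// sqr_ge0.
apply: le_trans Q2 _.
set W := expR (2 * mu * _); set X := x s ^+ 2 + _.
have -> : K * X * W = c2 * ((c1 * X) * (W * expR (L * (N ^+ 2 / 2 + Mb + Mm)))).
  by rewrite /K; ring.
apply: ler_wpM2l => //; apply: le_trans QF _; apply: ler_pM => //.
- by apply: addr_ge0; [|apply: mulr_ge0 => //]; exact: sqr_ge0.
- by rewrite -expRD ler_expR.
Qed.

(** * From complex matrices to real functions *)

Lemma normc_ge_Im (R : rcfType) (z : R[i]) : `|complex.Im z|%:C <= `|z|.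
Proof.
by rewrite normc_def lecR -sqrtr_sqr ler_wsqrtr// lerDr sqr_ge0.
Qed.

Lemma entry_le_mx_norm (K : numDomainType) (p q : nat) (M : 'M[K]_(p, q)) i j :
  `|M i j| <= mx_norm M.
Proof.
by rewrite mx_normE -[leLHS]nngE num_le; exact: (le_bigmax _ _ (i, j)).
Qed.

Lemma mx_norm_le (K : numDomainType) (p q : nat) (M : 'M[K]_(p, q)) (B : K) :
  0 <= B -> (forall i j, `|M i j| <= B) -> mx_norm M <= B.
Proof.
by move=> B0 MB; have [->//|/mx_norm_neq0[ij ->]] := eqVneq (mx_norm M) 0.
Qed.

(** A real-linear functional of norm at most 1 commutes with the limit of difference quotients. The
    conclusion supplies what [gronwall] takes: derivatives inside and continuity up to the
    boundary. *)
Lemma is_derive_nonneg_comp (R : realType) (p q : nat)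
    (phi : 'M[R[i]]_(p, q) -> R) (U : R -> 'M[R[i]]_(p, q)) (t : R) dU :
  {morph phi : A B / A - B} -> (forall r A, phi (r%:C *: A) = r * phi A) ->
  (forall A, `|phi A|%:C <= `|A|) ->
  0 <= t -> is_derive_nonneg U t dU ->
  (0 < t -> is_derive t 1 (fun r => phi (U r)) (phi dU)) /\
  (fun r => phi (U r)) @ within `[0, +oo[ (nbhs t) --> phi (U t).
Proof.
move=> phiB phiZ phi_le t0 dUt.
pose f r := phi (U r).
have quot (e : R) : 0 < e -> \forall r \near t, 0 <= r -> r != t ->
    `|phi dU - (r - t)^-1 * (f r - f t)| < e.
  move=> e0.
  have e0C : 0 < e%:C by rewrite ltcR.
  move/cvgrPdist_lt: dUt => /(_ _ e0C).
  rewrite near_withinE near_withinE; apply: filterS => r H r0 rt.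
  rewrite -ltcR; apply: le_lt_trans (H _ _); last 2 first.
  - by [].
  - by rewrite /= in_itv/= r0.
  by rewrite -phiB -phiZ -phiB.
split.
- move=> tp.
  have D : h^-1 *: ((f \o shift t) (h *: 1) - f t) @[h --> 0^'] --> phi dU.
    apply/cvgrPdist_lt => e e0.
    have := quot e e0.
    move=> /nbhs_ballP[/= d d0 Hd].
    rewrite near_withinE.
    (* Radius at most [t] keeps [h + t] in the half-line. *)
    exists (Num.min d t) => /=; first by rewrite lt_min d0.
    move=> h /=; rewrite sub0r normrN lt_min => /andP[hd ht] h0.
    have := Hd (h + t).
    rewrite /ball/= opprD addrCA subrr addr0 normrN => /(_ hd).
    rewrite addrK /GRing.scale/= mulr1; apply.
      by move: ht; rewrite ltr_norml; lra.
    by rewrite -subr_eq0 addrK.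
  split; first by apply/cvg_ex; exists (phi dU).
  exact: cvg_lim.
- apply/cvgrPdist_lt => e e0.
  have H := quot 1 ltr01.
  (* Near [t] the difference quotients are bounded by this number, so [f] satisfies a Lipschitz
     estimate at [t]. *)
  have c0 : 0 < `|phi dU| + 1 by rewrite ltr_wpDl.
  have ec : 0 < e / (`|phi dU| + 1) by rewrite divr_gt0.
  rewrite near_withinE; near=> r; rewrite /= in_itv/= andbT => r0.
  have [->|rt] := eqVneq r t; first by rewrite subrr normr0.
  have rt1 : `|t - r| < e / (`|phi dU| + 1) by near: r; exact: cvgr_dist_lt.
  have Hr : `|phi dU - (r - t)^-1 * (f r - f t)| < 1 by apply: (near H r).
  have rt0 : r - t != 0 by rewrite subr_eq0.
  have -> : phi (U t) - phi (U r) = - ((r - t) * ((r - t)^-1 * (f r - f t))).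
    by rewrite /f mulVKf//; ring.
  rewrite normrN normrM distrC; move: rt1.
  rewrite ltr_pdivlMr//; apply: le_lt_trans.
  rewrite ler_wpM2l//.
  rewrite -[X in `|X|](subrK (phi dU)); apply: le_trans (ler_normD _ _) _.
  by rewrite addrC lerD2l distrC ltW.
Unshelve. all: by end_near.
Qed.

(** For a negative radicand the principal root is purely imaginary and [Num.sqrt] returns 0, so one
    real formula serves both signs. *)
Lemma Re_mu_plus (R : realType) (b0 m0 : R) :
  complex.Re (mu_plus b0 m0) =
  - ((b0 + 1) / 2) + Num.sqrt ((b0 - 1) ^+ 2 / 4 - m0).
Proof.
rewrite /mu_plus /sqrtc /= expr0n/= addr0 sqrtr_sqr.
set d := _ - m0; congr (_ + _).
have [d0|d0] := leP 0 d.
  by congr Num.sqrt; rewrite ger0_norm//; field.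
by rewrite ltr0_norm// addNr mul0r sqrtr0 ler0_sqrtr// ltW.
Qed.

(** As [z = i N u2], one has [Re z = - N Im u2] and [Im z = N Re u2]: the first and fourth equations
    form one real system, the second and third another. *)
Lemma system_components (R : realType) (b m : R -> R) (b0 m0 N r : R) (n : nat)
    (xi : 'rV[R]_n) (V dV : 'M[R[i]]_2) (j : 'I_2) : N != 0 ->
  (1 + r)%:C *: dV = (matA b0 m0 N + matR b m b0 m0 N r xi) *m V ->
  let c := (1 + r) ^+ 2 * (euclidean_norm xi ^+ 2 + m r) in
  [/\ (1 + r) * complex.Re (dV 0 j) =
        - complex.Re (V 0 j) - N * complex.Im (V 1 j),
      (1 + r) * complex.Im (dV 0 j) =
        - complex.Im (V 0 j) + N * complex.Re (V 1 j),
      (1 + r) * complex.Re (dV 1 j) =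
        - (c / N * complex.Im (V 0 j)) - (1 + r) * b r * complex.Re (V 1 j) &
      (1 + r) * complex.Im (dV 1 j) =
        c / N * complex.Re (V 0 j) - (1 + r) * b r * complex.Im (V 1 j)].
Proof.
move=> N0 /matrixP sys c.
have := sys 0 j; have := sys 1 j.
rewrite !mxE !big_ord_recl !big_ord0 !mxE /= -!fmorphV.
have -> : lift ord0 ord0 = 1 :> 'I_2 by apply/val_inj.
rewrite -[ord0]/(0 : 'I_2).
case: (V 0 j) => x1 x2; case: (V 1 j) => y1 y2.
case: (dV 0 j) => dx1 dx2; case: (dV 1 j) => dy1 dy2.
simpc => -[h1 h2] [h3 h4] /=.
by split => //; rewrite ?h1 ?h2 /c; field.
Qed.

Lemma is_derive_nonneg_entry (R : realType) (p q : nat) (phi : R[i] -> R)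
    (U : R -> 'M[R[i]]_(p, q)) i j (t : R) dU :
  {morph phi : u v / u - v} -> (forall a u, phi (a%:C * u) = a * phi u) ->
  (forall u, `|phi u|%:C <= `|u|) -> 0 <= t -> is_derive_nonneg U t dU ->
  (0 < t -> is_derive t 1 (fun r => phi (U r i j)) (phi (dU i j))) /\
  (fun r => phi (U r i j)) @ within `[0, +oo[ (nbhs t) --> phi (U t i j).
Proof.
move=> phiB phiZ phi_le.
apply: (@is_derive_nonneg_comp R p q (fun M => phi (M i j))).
- by move=> M1 M2; rewrite !mxE phiB.
- by move=> a M; rewrite mxE phiZ.
- by move=> M; apply: le_trans (phi_le _) _; exact: entry_le_mx_norm.
Qed.

(** * The estimate for the fundamental solution *)

Theorem theorem2p1 (R : realType) (n : nat) (b m : R -> R) (b0 m0 N : R)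
    (E : R -> R -> 'rV[R]_n -> 'M[R[i]]_2)
    (cont_b : {within `[0, +oo[, continuous b})
    (cont_m : {within `[0, +oo[, continuous m})
    (lim_b : (1 + t) * b t @[t --> +oo] --> b0)
    (lim_m : (1 + t) ^+ 2 * m t @[t --> +oo] --> m0)
    (int_b : (\int[lebesgue_measure]_(t in `[1%R, +oo[)
                (`|t * b t - b0| / t)%:E < +oo)%E)
    (int_m : (\int[lebesgue_measure]_(t in `[1%R, +oo[)
                (`|t ^+ 2 * m t - m0| / t)%:E < +oo)%E)
    (ne_disc : 4 * m0 <> (b0 - 1) ^+ 2)
    (N_gt0 : 0 < N)
    (fund_E : fundamental_solution b m b0 m0 N E) :
  exists C : R, forall (t s : R) (xi : 'rV[R]_n),
    0 <= s -> s <= t -> (1 + t) * euclidean_norm xi <= N ->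
    `|E t s xi| <= (C * ((1 + t) / (1 + s)) `^ complex.Re (mu_plus b0 m0))%:C.
Proof.
have [K HK] :=
  @real_system_bound R b m b0 m0 N cont_b cont_m int_b int_m ne_disc N_gt0.
have N0 : N != 0 by rewrite gt_eqF.
(* [1 + N ^+ 2] bounds the initial value of [|u1|^2 + N^2 |u2|^2] for the columns of the identity;
   [1 + N ^- 2] undoes the weight [N ^+ 2] on [|u2|^2]. The absolute value is taken because [HK]
   does not record the sign of [K]. *)
pose B := `|K| * (1 + N ^+ 2) * (1 + N ^- 2).
exists (Num.sqrt B) => t s xi s0 st tN.
rewrite Re_mu_plus.
set P := _ `^ _.
have P0 : 0 <= P by exact: powR_ge0.
have t0 : 0 <= t by exact: le_trans st.
have k0 : 0 <= euclidean_norm xi by exact: sqrtr_ge0.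
have [Es dEs] := fund_E s xi s0.
pose V r := E r s xi.
have reE i j r dV : 0 <= r -> is_derive_nonneg V r dV ->
    (0 < r -> is_derive r 1 (fun y => complex.Re (V y i j))
      (complex.Re (dV i j))) /\
    (fun y => complex.Re (V y i j)) @ within `[0, +oo[ (nbhs r) -->
    complex.Re (V r i j).
  apply: (@is_derive_nonneg_entry R 2 2 (@complex.Re R)).
  - by move=> [? ?] [? ?].
  - by move=> a [? ?]; simpc.
  - exact: normc_ge_Re.
have imE i j r dV : 0 <= r -> is_derive_nonneg V r dV ->
    (0 < r -> is_derive r 1 (fun y => complex.Im (V y i j))
      (complex.Im (dV i j))) /\
    (fun y => complex.Im (V y i j)) @ within `[0, +oo[ (nbhs r) -->
    complex.Im (V r i j).
  apply: (@is_derive_nonneg_entry R 2 2 (@complex.Im R)).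
  - by move=> [? ?] [? ?].
  - by move=> a [? ?]; simpc.
  - exact: normc_ge_Im.
have cont (f : R -> R) :
    (forall r : R, 0 <= r -> f @ within `[0, +oo[ (nbhs r) --> f r) ->
    {within `[0, +oo[, continuous f}.
  move=> cf; apply/subspace_continuousP => r /=.
  by rewrite in_itv/= andbT; exact: cf.
have cRe i j : {within `[0, +oo[, continuous (fun r => complex.Re (V r i j))}.
  apply: cont => r r0; have [dV dVr _] := dEs r r0.
  exact: (reE i j r dV r0 dVr).2.
have cIm i j : {within `[0, +oo[, continuous (fun r => complex.Im (V r i j))}.
  apply: cont => r r0; have [dV dVr _] := dEs r r0.
  exact: (imE i j r dV r0 dVr).2.
have cZ (a : R) (f : R -> R) : {within `[0, +oo[, continuous f} ->
    {within `[0, +oo[, continuous (fun r => a * f r)}.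
  by move=> /subspace_continuousP cf; apply/subspace_continuousP => r r0;
    apply: cvgM; [exact: cvg_cst|exact: cf].
have col j : `|V t 0 j| <= (Num.sqrt B * P)%:C
    /\ `|V t 1 j| <= (Num.sqrt B * P)%:C.
  (* The real parts of [(x, z)] for column [j]; [bnd2] treats the imaginary parts. *)
  have bnd1 : complex.Re (V t 0 j) ^+ 2 + (- N * complex.Im (V t 1 j)) ^+ 2 <=
      K * (complex.Re (V s 0 j) ^+ 2 + (- N * complex.Im (V s 1 j)) ^+ 2) *
      P ^+ 2.
    apply: (HK (fun r => complex.Re (V r 0 j))
      (fun r => - N * complex.Im (V r 1 j))
      (euclidean_norm xi)) => //; first exact: cZ.
    move=> r r0; have [dV dVr dVE] := dEs r (ltW r0).
    have [h1 _ _ h4] := @system_components R b m b0 m0 N r n xi _ _ j N0 dVE.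
    exists (complex.Re (dV 0 j)), (- N * complex.Im (dV 1 j)); split.
    - exact: (reE 0 j r dV (ltW r0) dVr).1.
    - exact: (is_deriveZ (- N) ((imE 1 j r dV (ltW r0) dVr).1 r0)).
    - by rewrite h1; ring.
    - by rewrite mulrCA h4; field.
  have bnd2 : complex.Im (V t 0 j) ^+ 2 + (N * complex.Re (V t 1 j)) ^+ 2 <=
      K * (complex.Im (V s 0 j) ^+ 2 + (N * complex.Re (V s 1 j)) ^+ 2) *
      P ^+ 2.
    apply: (HK (fun r => complex.Im (V r 0 j))
      (fun r => N * complex.Re (V r 1 j))
      (euclidean_norm xi)) => //; first exact: cZ.
    move=> r r0; have [dV dVr dVE] := dEs r (ltW r0).
    have [_ h2 h3 _] := @system_components R b m b0 m0 N r n xi _ _ j N0 dVE.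
    exists (complex.Im (dV 0 j)), (N * complex.Re (dV 1 j)); split.
    - exact: (imE 0 j r dV (ltW r0) dVr).1.
    - exact: (is_deriveZ N ((reE 1 j r dV (ltW r0) dVr).1 r0)).
    - by rewrite h2; ring.
    - by rewrite mulrCA h3; field.
  pose S := complex.Re (V s 0 j) ^+ 2 + (- N * complex.Im (V s 1 j)) ^+ 2 +
     (complex.Im (V s 0 j) ^+ 2 + (N * complex.Re (V s 1 j)) ^+ 2).
  have S0 : 0 <= S by rewrite /S !addr_ge0 ?sqr_ge0.
  have N2 : 0 <= N ^+ 2 by exact: sqr_ge0.
  have S1 : S <= 1 + N ^+ 2.
    rewrite /S /V Es !mxE.
    by case: (0 == j); case: (1 == j); rewrite /=; lra.
  pose W := `|K| * (1 + N ^+ 2) * P ^+ 2.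
  have KS : K * S * P ^+ 2 <= W.
    apply: ler_wpM2r; first exact: sqr_ge0.
    by apply: le_trans (ler_norm _) _; rewrite normrM (ger0_norm S0) ler_wpM2l.
  have tot : complex.Re (V t 0 j) ^+ 2 + complex.Im (V t 0 j) ^+ 2 +
      N ^+ 2 * (complex.Re (V t 1 j) ^+ 2 + complex.Im (V t 1 j) ^+ 2) <= W.
    by apply: le_trans KS; rewrite /S; lra.
  have W0 : 0 <= W.
    by apply: mulr_ge0; [apply: mulr_ge0 => //|exact: sqr_ge0]; lra.
  have iN0 : 0 <= N ^- 2 by rewrite invr_ge0.
  have BW : B * P ^+ 2 = W + N ^- 2 * W by rewrite /B /W; ring.
  have norm_le u : complex.Re u ^+ 2 + complex.Im u ^+ 2 <= B * P ^+ 2 ->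
      `|u| <= (Num.sqrt B * P)%:C.
    move=> uB; rewrite normc_def lecR -[P]ger0_norm// -sqrtr_sqr.
    rewrite mulrC -sqrtrM ?sqr_ge0//.
    by rewrite ler_wsqrtr// mulrC.
  have sq0 i : 0 <= complex.Re (V t i j) ^+ 2 + complex.Im (V t i j) ^+ 2.
    by rewrite addr_ge0 ?sqr_ge0.
  (* By [tot], the upper entry is bounded through [W] and the lower one through [N ^- 2 * W]. *)
  split; apply: norm_le; rewrite BW.
    have := mulr_ge0 iN0 W0; have := mulr_ge0 N2 (sq0 1); lra.
  apply: (@le_trans _ _ (N ^- 2 * W)); last by rewrite lerDr.
  rewrite mulrC ler_pdivlMr ?exprn_gt0// mulrC.
  have := sq0 0; lra.
apply: mx_norm_le => [|i j]; first by rewrite lecR mulr_ge0 ?sqrtr_ge0.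
have [c0 c1] := col j.
by case: i => [[|[|i]] Hi] //; [move: c0|move: c1];
  congr (`|V t _ j| <= _); exact: val_inj.
Qed.
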